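(* Let $\mathbb K$ be a field and $R:=\mathbb K[x_0,\ldots,x_n]$. Let $s\geq n+1$ and let $\mathcal A=\{H_1,\ldots,H_s\}$ be a generic collection of hyperplanes in $\mathbb P^n$, with $H_i=V(\ell_i)$ for linear forms $\ell_1,\ldots,\ell_s\in R$. Let $N=s-1$ and let $\mathcal A'=\{H'_0,\ldots,H'_N\}$ be the set of coordinate hyperplanes $H'_i=V(z_i)$ in $\mathbb P^N$, where $z_0,\ldots,z_N$ are the coordinate variables. For $1\leq c\leq n$, let $I:=I(V_c(\mathcal A,\mathbb P^n))\subset \mathbb K[x_0,\ldots,x_n]$ and $I':=I(V_c(\mathcal A',\mathbb P^N))\subset\mathbb K[z_0,\ldots,z_N]$ be the defining ideals of the star configurations of codimension $c$ with supports $\mathcal A$ and $\mathcal A'$, respectively. Then $\rho(I)=\rho(I')$.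
   Context: The collection $\mathcal A$ is generic if any $n+1$ of the linear forms $\ell_1,\ldots,\ell_s$ are linearly independent. The defining ideals of the star configurations are $$I(V_c(\mathcal A,\mathbb P^n))=\bigcap_{1\leq j_1<\cdots<j_c\leq s}\langle \ell_{j_1},\ldots,\ell_{j_c}\rangle,\qquad I(V_c(\mathcal A',\mathbb P^N))=\bigcap_{0\leq j_1<\cdots<j_c\leq N}\langle z_{j_1},\ldots,z_{j_c}\rangle,$$ and for $m\geq 1$ their $m$-th symbolic powers are $$I^{(m)}=\bigcap_{1\leq j_1<\cdots<j_c\leq s}\langle \ell_{j_1},\ldots,\ell_{j_c}\rangle^m,\qquad {I'}^{(m)}=\bigcap_{0\leq j_1<\cdots<j_c\leq N}\langle z_{j_1},\ldots,z_{j_c}\rangle^m.$$ The resurgence of such an ideal $J$ is $$\rho(J):=\sup\left\{\frac{m}{r}\,\Big|\, m,r\ge 1 \text{ integers with } J^{(m)}\nsubseteq J^r\right\}.$$ *)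

(* Defs.v *)
From HB Require Import structures.
From mathcomp Require Import all_boot all_order all_algebra.
From mathcomp Require Import classical_sets reals constructive_ereal ereal.
(* The notations of mpoly are incompatible with those of constructive_ereal. *)
From mathcomp Require Import -(notations) mpoly.

Set Implicit Arguments.
Unset Strict Implicit.
Unset Printing Implicit Defensive.

Import GRing.Theory Num.Theory.

Local Open Scope classical_set_scope.
Local Open Scope ring_scope.

Section Ideals.
Variable A : comNzRingType.
Implicit Types (G I J : set A) (k : nat).

Definition ideal_span G : set A :=
  [set x | exists k (a g : 'I_k -> A),
     (forall i, G (g i)) /\ x = \sum_(i < k) a i * g i].

Definition ideal_mul I J : set A :=
  ideal_span [set z | exists x y, [/\ I x, J y & z = x * y]].

Fixpoint ideal_exp I k : set A :=
  if k is k'.+1 then ideal_mul I (ideal_exp I k') else setT.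

End Ideals.

Section StarConfiguration.
Variables (K : fieldType) (n s c : nat).
Implicit Types (l : 'I_s -> mpoly n K) (S : {set 'I_s}) (m : nat).

Definition ideal_of_forms l S : set (mpoly n K) :=
  ideal_span [set l j | j in [set` S]].

Definition star_ideal l : set (mpoly n K) :=
  \bigcap_(S in [set S : {set 'I_s} | #|S| = c]) ideal_of_forms l S.

Definition star_symbolic_power l m : set (mpoly n K) :=
  \bigcap_(S in [set S : {set 'I_s} | #|S| = c])
    ideal_exp (ideal_of_forms l S) m.

End StarConfiguration.

(* P^n has n.+1 homogeneous coordinates, and the linear forms in them are
   the elements of the finite dimensional vector space [dhomog n.+1 K 1]. *)
Definition generic_collection (K : fieldType) (n s : nat)
    (l : 'I_s -> dhomog n.+1 K 1) : Prop :=
  forall S : {set 'I_s}, #|S| = n.+1 -> free [seq l j | j in S].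

(* [sympow m] is the m-th symbolic power of the ideal [J]. *)
Definition resurgence (R : realType) (A : comNzRingType)
    (sympow : nat -> set A) (J : set A) : \bar R :=
  ereal_sup [set x | exists m r : nat, [/\ (1 <= m)%N, (1 <= r)%N,
    ~ (sympow m `<=` ideal_exp J r) & x = (m%:R / r%:R)%:E]].

Definition star_resurgence (R : realType) (K : fieldType) (n s c : nat)
    (l : 'I_s -> mpoly n K) : \bar R :=
  resurgence R (star_symbolic_power c l) (star_ideal c l).

Definition coordinate_forms (K : fieldType) (s : nat) :
    'I_s -> mpoly s K :=
  fun i => mpolyX K (mnm1 i).

(* Main.v *)
Require Import Defs.
From HB Require Import structures.
From mathcomp Require Import all_boot all_order all_algebra.
From mathcomp Require Import classical_sets reals constructive_ereal ereal.
From mathcomp Require Import -(notations) mpoly.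
(* fintype and finset come again so that set0, subsetP, etc. denote the
   notions on finite sets; those of classical_sets are qualified. *)
From mathcomp Require Import fintype finset zify.

(** The two resurgences agree because the containment of the [m]-th symbolic
power in the [r]-th power is governed, for both ideals, by one and the same
condition on exponent vectors.

Write l^a for the product of the l_i^(a_i), and let E_m be the set of the
exponent vectors a whose sum over every c-element set of indices is at least
m. For coordinate forms the m-th symbolic power is obviously the monomial ideal
spanned by the l^a with a in E_m. The heart of the proof is that this remains
true for generic linear forms ([monomial_star_intersection]). Usually one
deduces it from the Cohen-Macaulay property of the coordinate ideals, which
makes specialization to n+1 variables harmless. Here it is proved by hand, by
induction on c: modulo one form l_s, the intersection becomes that of a star
configuration of codimension c-1 on the other forms, so an element f of the
intersection is a combination of monomials l^a with a in E_m plus a multiple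
l_s h. Then h lies in the intersection of the colon ideals by l_s, which is an
ideal of the same shape with the exponent of l_s shifted by one, and one
repeats until the shifts exceed m. For this to close up one reduces modulo a
form whose shift is the smallest. The only fact about the forms that is used is
that the colon by l_s of an ideal spanned by monomials in few forms is computed
as if the forms were variables; at most n+1 generic forms are part of a system
of coordinates, so this is a change of variables
([regular_family_coordinates]).

Put d = s-c+1, so that the ideal I itself is spanned by the products of d
distinct forms. Then I^(m) is contained in I^r if and only if

   for all a in E_m, the sum of the min(a_i, r) is at least r d

([star_containment]). If a satisfies this inequality, then l^a is a multiple of
a product of r products of d distinct forms ([mon_mem_exp], an argument of
Gale-Ryser type). If some a in E_m violates it, then the truncation of a at r
is still in E_m ([symbolic_exps_truncate]), and it gives a nonzero element of
I^(m) of degree less than r d, whereas I^r lives in degrees at least r d. The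
criterion does not mention the forms, so the two suprema are taken over the
same set. *)

Set Implicit Arguments.
Unset Strict Implicit.
Unset Printing Implicit Defensive.

Import GRing.Theory.

Local Open Scope classical_set_scope.
Local Open Scope ring_scope.

(** * Ideals spanned by a set, and their powers *)

Section IdealTheory.
Variable A : comNzRingType.
Implicit Types (G I J : set A) (k : nat) (x y : A).

Definition is_ideal J : Prop :=
  [/\ J 0, forall x y, J x -> J y -> J (x + y) & forall x y, J y -> J (x * y)].

Lemma is_ideal_sum J (T : Type) (r : seq T) (P : pred T) (f : T -> A) :
  is_ideal J -> (forall i, P i -> J (f i)) -> J (\sum_(i <- r | P i) f i).
Proof. by case=> J0 JD _ Jf; apply: big_ind. Qed.

Lemma is_ideal_opp J x : is_ideal J -> J x -> J (- x).
Proof. by case=> _ _ JM Jx; rewrite -mulN1r; apply: JM. Qed.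

Lemma ideal_span_is_ideal G : is_ideal (ideal_span G).
Proof.
split.
- by exists 0, (fun=> 0), (fun=> 0); split=> [[] //|]; rewrite big_ord0.
- move=> _ _ [k [a [g [Gg ->]]]] [k' [a' [g' [Gg' ->]]]].
  exists (k + k')%N,
    (fun i => match split i with inl j => a j | inr j => a' j end),
    (fun i => match split i with inl j => g j | inr j => g' j end).
  split=> [i|]; first by case: (split i).
  rewrite big_split_ord /=; congr (_ + _); apply: eq_bigr => i _.
    by rewrite (unsplitK (inl i)).
  by rewrite (unsplitK (inr i)).
move=> x _ [k [a [g [Gg ->]]]].
exists k, (fun i => x * a i), g; split=> //.
by rewrite mulr_sumr; apply: eq_bigr => i _; rewrite mulrA.
Qed.

Lemma sub_ideal_span G : G `<=` ideal_span G.
Proof.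
move=> x Gx; exists 1, (fun=> 1), (fun=> x); split=> //.
by rewrite big_ord1 mul1r.
Qed.

Lemma ideal_span_min G J : is_ideal J -> G `<=` J -> ideal_span G `<=` J.
Proof.
move=> Ji GJ _ [k [a [g [Gg ->]]]]; apply: is_ideal_sum => // i _.
by case: Ji => _ _; apply; apply: GJ.
Qed.

Lemma ideal_exp_is_ideal J k : is_ideal (ideal_exp J k).
Proof. by case: k => [|k]; [split|apply: ideal_span_is_ideal]. Qed.

Lemma ideal_expS_mem J k x y :
  J x -> ideal_exp J k y -> ideal_exp J k.+1 (x * y).
Proof. by move=> Jx Jy; apply: sub_ideal_span; exists x, y. Qed.

Lemma ideal_exp1 J : is_ideal J -> ideal_exp J 1 = J.
Proof.
move=> Ji; apply/seteqP; split=> [|x Jx].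
  apply: ideal_span_min => // _ [x [y [Jx _ ->]]].
  by rewrite mulrC; case: Ji => _ _; apply.
by rewrite -[x]mulr1; apply: ideal_expS_mem.
Qed.

(** Used with the filtration by order of vanishing at the origin, this bounds the
degrees of the elements of a power from below. *)
Lemma ideal_exp_filtration J (F : nat -> set A) :
  (forall k, is_ideal (F k)) -> F 0%N = classical_sets.setT ->
  (forall i j x y, F i x -> F j y -> F (i + j)%N (x * y)) ->
  forall d, J `<=` F d -> forall r, ideal_exp J r `<=` F (d * r)%N.
Proof.
move=> Fi F0 FM d JF; elim=> [|r IHr]; first by rewrite muln0 F0.
apply: ideal_span_min => // _ [x [y [Jx Jy ->]]].
by rewrite mulnS; apply: FM; [apply: JF|apply: IHr].
Qed.

End IdealTheory.

(** * Ideals spanned by monomials in a family of elements *)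

Section MonomialIdeals.
Variables (A : comNzRingType) (I : finType) (l : I -> A).
Implicit Types (a b : I -> nat) (E F : set (I -> nat)) (s : I) (T D U : {set I}).

Definition mon a : A := \prod_i l i ^+ a i.

Definition monomial_ideal E : set A := ideal_span [set mon a | a in E].

Definition upward E := forall a b, (forall i, (a i <= b i)%N) -> E a -> E b.

Definition unit_exp s : I -> nat := fun i => i == s.

Lemma monD a b : mon (fun i => a i + b i)%N = mon a * mon b.
Proof. by rewrite /mon -big_split; apply: eq_bigr => i _; rewrite exprD. Qed.

Lemma eq_mon a b : a =1 b -> mon a = mon b.
Proof. by move=> ab; apply: eq_bigr => i _; rewrite ab. Qed.

Lemma mon_unit s : mon (unit_exp s) = l s.
Proof.
rewrite /mon (bigD1 s) //= big1 ?mulr1 /unit_exp ?eqxx // => i /negPf ->.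
by rewrite expr0.
Qed.

Lemma mon0 : mon (fun=> 0%N) = 1.
Proof. by rewrite /mon big1. Qed.

Lemma mon_sub a b : (forall i, (a i <= b i)%N) ->
  mon b = mon (fun i => b i - a i)%N * mon a.
Proof. by move=> ab; rewrite -monD; apply: eq_mon => i; rewrite subnK. Qed.

Lemma monomial_ideal_is_ideal E : is_ideal (monomial_ideal E).
Proof. exact: ideal_span_is_ideal. Qed.

Lemma mem_monomial_ideal E a : E a -> monomial_ideal E (mon a).
Proof. by move=> Ea; apply: sub_ideal_span; exists a. Qed.

Lemma monomial_ideal_min E J : is_ideal J -> (forall a, E a -> J (mon a)) ->
  monomial_ideal E `<=` J.
Proof. by move=> Ji EJ; apply: ideal_span_min => // _ [a Ea <-]; apply: EJ. Qed.

Lemma monomial_idealS E F : E `<=` F -> monomial_ideal E `<=` monomial_ideal F.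
Proof.
move=> EF; apply: monomial_ideal_min; first exact: monomial_ideal_is_ideal.
by move=> a /EF; apply: mem_monomial_ideal.
Qed.

(** The exponents of the colon of a monomial ideal by the variable [s]; for
arbitrary elements [l], only the inclusion [monomial_ideal_shift] holds. *)
Definition shift s E : set (I -> nat) :=
  [set a | E (fun i => a i + unit_exp s i)%N].

Lemma monomial_ideal_shift s E h :
  monomial_ideal (shift s E) h -> monomial_ideal E (l s * h).
Proof.
case: (monomial_ideal_is_ideal E) => E0 ED EM.
move: h; apply: (@monomial_ideal_min _ [set h | monomial_ideal E (l s * h)]).
  split=> [|x y|x y] /=; first by rewrite mulr0.
    by rewrite mulrDr; apply: ED.
  by rewrite mulrCA; apply: EM.
move=> a Ea /=; rewrite mulrC -(mon_unit s) -monD.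
exact: mem_monomial_ideal.
Qed.

(** This lifts a representation modulo [l s] by monomials to the ring, without
passing to the quotient. *)
Lemma monomial_ideal_split s E f :
  monomial_ideal (E `|` [set a | (0 < a s)%N]) f ->
  exists g h, monomial_ideal E g /\ f = g + l s * h.
Proof.
case: (monomial_ideal_is_ideal E) => E0 ED EM.
move: f; apply: (@monomial_ideal_min _
  [set f | exists g h, monomial_ideal E g /\ f = g + l s * h]).
  split=> [|_ _ [g [h [Eg ->]]] [g' [h' [Eg' ->]]]|x _ [g [h [Eg ->]]]].
  - by exists 0, 0; rewrite mulr0 addr0.
  - exists (g + g'), (h + h'); split; first exact: ED.
    by rewrite mulrDr addrACA.
  - exists (x * g), (x * h); split; first exact: EM.
    by rewrite mulrDr (mulrCA x).
move=> a [Ea|/= as0].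
  exists (mon a), 0; rewrite mulr0 addr0; split=> //.
  exact: mem_monomial_ideal.
exists 0, (mon (fun i => a i - unit_exp s i)%N); split=> //.
rewrite add0r mulrC -(mon_unit s); apply: mon_sub => i.
by rewrite /unit_exp; case: eqP => // ->.
Qed.

End MonomialIdeals.

(** * Intersections of powers of ideals generated by forms *)

Section StarIntersection.
Variables (A : comNzRingType) (I : finType) (l : I -> A).
Implicit Types (a b : I -> nat) (E : set (I -> nat)) (s : I) (T D U : {set I}).

(** Any [k] of the [l i] behave like variables as far as colons of monomial
ideals are concerned: the family [l] need not be algebraically independent as a
whole, and indeed it is not when there are more forms than variables. *)
Definition regular_family k : Prop :=
  forall E U s h, (#|s |: U| <= k)%N -> upward E ->
    (forall a b, {in U, a =1 b} -> E a -> E b) ->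
    monomial_ideal l E (l s * h) -> monomial_ideal l (shift s E) h.

Definition meets D : set (I -> nat) := [set a | exists2 i, i \in D & (0 < a i)%N].

(** If the [l i] were variables, these would be the exponents of the ideal generated
by the [l i] with [i] in [D] and by the colon of the [m]-th power of
(l_i, i in T) by the monomial l^b. Adjoining the
forms of [D] plays the role of passing to the quotient by them, and the shift
[b] records the colons already taken. *)
Definition order_exps D b m T : set (I -> nat) :=
  [set a | (m <= \sum_(i in T) (a i + b i))%N] `|` meets D.

Definition star_exps D b m c : set (I -> nat) :=
  [set a | forall T, T \subset ~: D -> #|T| = c ->
             (m <= \sum_(i in T) (a i + b i))%N] `|` meets D.

Lemma upward_order_exps D b m T : upward (order_exps D b m T).
Proof.
move=> a a' aa' [/= ma|[i iD ai]]; [left|right] => /=.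
  by apply: leq_trans ma _; apply: leq_sum => i _; rewrite leq_add2r.
by exists i => //; apply: leq_trans ai _.
Qed.

Lemma order_exps_supp D b m T a a' :
  {in T :|: D, a =1 a'} -> order_exps D b m T a -> order_exps D b m T a'.
Proof.
move=> aa' [/= ma|[i iD ai]]; [left|right] => /=.
  rewrite (eq_bigr (fun i => a i + b i)%N) // => i iT.
  by rewrite aa' // inE iT.
by exists i => //; rewrite -aa' // inE iD orbT.
Qed.

Lemma shift_order_exps D b m T s : s \notin D ->
  shift s (order_exps D b m T) `<=`
  order_exps D (fun i => b i + unit_exp s i)%N m T.
Proof.
move=> sD a [/= ma|[i iD /= ai]]; [left|right] => /=.
  by under eq_bigr do rewrite addnA addnAC.
exists i => //; move: ai; rewrite /unit_exp; have [is_|_] := eqVneq i s.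
  by rewrite -is_ iD in sD.
by rewrite addn0.
Qed.

Lemma star_exps_shift D b m c s :
  star_exps D (fun i => b i + unit_exp s i)%N m c `<=`
  shift s (star_exps D b m c).
Proof.
move=> a [/= ma|[i iD /= ai]]; [left|right] => /=.
  by move=> T TD Tc; under eq_bigr do rewrite addnAC -addnA; apply: ma.
by exists i => //; rewrite addn_gt0 ai.
Qed.

Lemma star_exps_sub_order D b m c T :
  T \subset ~: D -> #|T| = c -> star_exps D b m c `<=` order_exps D b m T.
Proof. by move=> TD Tc a [/= ma|aD]; [left; apply: ma|right]. Qed.

(** Modulo [l s], the index [s] contributes only its shift, so a condition on
c+1 indices including [s] becomes a condition on the c others. *)
Lemma order_exps_restrict D b m T s : s \notin T -> s \notin D ->
  order_exps D b m (s |: T) `<=` order_exps (s |: D) b (m - b s) T.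
Proof.
move=> sT sD a [/= ma|[i iD ai]]; last first.
  by right; exists i => //; rewrite !inE iD orbT.
have [as0|as_gt0] := posnP (a s); last by right; exists s; rewrite // !inE eqxx.
by left => /=; move: ma; rewrite big_setU1 //= as0 leq_subLR.
Qed.

(** The conditions modulo [l s] come only from the sets [T] that contain [s]; a set
[T] that avoids [s] is handled by exchanging one of its elements for [s], which
does not increase the sum because the shift at [s] is minimal. *)
Lemma star_exps_lift D b m c s :
  s \notin D -> (b s <= m)%N -> (forall i, i \notin D -> (b s <= b i)%N) ->
  star_exps (s |: D) b (m - b s) c `<=`
  star_exps D b m c.+1 `|` [set a | (0 < a s)%N].
Proof.
move=> sD bsm bmin a [/= ma|[i]]; last first.
  rewrite !inE => /orP[/eqP->|iD] ai; [right|left; right] => //.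
  by exists i.
left; left => /= T TD Tc.
(* i is the element dropped from T: s itself if possible. *)
suff [i [iT ii sTi]] : exists i, [/\ i \in T, (b s <= b i)%N & s \notin T :\ i].
  rewrite (big_setD1 i) //=.
  have H : (m <= b s + \sum_(j in T :\ i) (a j + b j))%N.
    rewrite -leq_subLR; apply: ma; last by move: Tc; rewrite (cardsD1 i) iT => -[].
    by rewrite setCU subsetI subsetC sub1set inE sTi (subset_trans (subsetDl _ _)).
  apply: leq_trans H _; rewrite leq_add2r.
  exact: leq_trans ii (leq_addl _ _).
have [sT|sT] := boolP (s \in T); first by exists s; rewrite !inE eqxx.
have /set0Pn[i iT] : T != set0 by rewrite -card_gt0 Tc.
exists i; split=> //; last by rewrite !inE (negPf sT) andbF.
by apply: bmin; have := subsetP TD i iT; rewrite inE.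
Qed.

(** Intersection commutes with forming monomial ideals, for the particular ideals
met with star configurations. The inner induction runs on the total deficit of
the shifts [b] with respect to [m]. *)
Theorem monomial_star_intersection k : regular_family k ->
  forall c D b m f, (#|D| + c < k)%N ->
    (forall T, T \subset ~: D -> #|T| = c ->
       monomial_ideal l (order_exps D b m T) f) ->
    monomial_ideal l (star_exps D b m c) f.
Proof.
move=> reg; elim=> [|c IHc] D b m f Dk fT.
  have := fT set0; rewrite cards0 sub0set => /(_ isT erefl).
  apply: monomial_idealS => a [/= ma|aD]; [left|by right] => T _ /cards0_eq ->.
  by [].
have [p] := ubnP (\sum_(i in ~: D) (m - b i))%N.
elim: p b f fT => // p IHp b f fT /ltnSE-bp.
(* If all shifts reach m, every condition is void and the ideal is the ring. *)
have [big|] := boolP [forall i, (i \notin D) ==> (m <= b i)%N].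
  rewrite -[f]mulr1 -(mon0 l).
  case: (monomial_ideal_is_ideal l (star_exps D b m c.+1)) => _ _; apply.
  apply: mem_monomial_ideal; left => T TD Tc.
  have /set0Pn[i iT] : T != set0 by rewrite -card_gt0 Tc.
  rewrite (bigD1 i) //= add0n; apply: leq_trans (leq_addr _ _).
  by have /forallP/(_ i)/implyP := big; apply; have := subsetP TD i iT; rewrite inE.
rewrite negb_forall => /existsP[s0]; rewrite negb_imply -ltnNge => /andP[s0D bs0].
(* Otherwise split f = g + l_s h modulo the form with the smallest shift. *)
case: (@arg_minnP _ s0 (fun i => i \notin D) b s0D) => s sD bmin.
have bsm : (b s < m)%N by apply: leq_ltn_trans (bmin _ s0D) bs0.
have /monomial_ideal_split[g [h [gG fE]]] : monomial_ideal l
    (star_exps D b m c.+1 `|` [set a | (0 < a s)%N]) f.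
  apply: (monomial_idealS (star_exps_lift sD (ltnW bsm) bmin)).
  apply: IHc => [|T TD Tc]; first by rewrite cardsU1 sD add1n addSn -addnS.
  have [TD' sT] : T \subset ~: D /\ s \notin T.
    by move: TD; rewrite setCU subsetI subsetC sub1set inE => /andP[].
  apply: (monomial_idealS (order_exps_restrict sT sD)); apply: fT.
    by rewrite subUset sub1set inE sD.
  by rewrite cardsU1 sT Tc.
case: (monomial_ideal_is_ideal l (star_exps D b m c.+1)) => _ ED _.
(* The remaining factor h satisfies the conditions for the shift b + e_s. *)
rewrite fE; apply: ED => //; apply: monomial_ideal_shift.
apply: (monomial_idealS (@star_exps_shift _ _ _ _ _)); apply: IHp.
  move=> T TD Tc; apply: (monomial_idealS (shift_order_exps sD)).
  apply: (reg _ (T :|: D)).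
  - move: Dk; rewrite -Tc !cardsU1 cardsU.
    by case: (s \notin _) => /=; lia.
  - exact: upward_order_exps.
  - by move=> a a'; apply: order_exps_supp.
  case: (monomial_ideal_is_ideal l (order_exps D b m T)) => _ OD _.
  rewrite -[l s * h](addKr g) -fE addrC; apply: OD; first exact: fT.
  apply: is_ideal_opp; first exact: monomial_ideal_is_ideal.
  exact: (monomial_idealS (star_exps_sub_order TD Tc)).
apply: leq_trans bp; rewrite (bigD1 s) ?inE // [leqRHS](bigD1 s) ?inE //=.
rewrite {1}/unit_exp eqxx addn1 -addSn; apply: leq_add; first by lia.
by apply: leq_sum => i _; rewrite leq_sub2l // leq_addr.
Qed.

End StarIntersection.

(** * Powers of ideals and products of distinct forms *)

Lemma exists_set_between (T : finType) (B C : {set T}) k :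
  B \subset C -> (#|B| <= k <= #|C|)%N ->
  exists S : {set T}, [/\ B \subset S, S \subset C & #|S| = k].
Proof.
move=> BC /andP[Bk kC].
exists (B :|: [set x in take (k - #|B|) (enum (C :\: B))]%SET); split.
- exact: finset.subsetUl.
- rewrite subUset BC; apply/subsetP => x.
  by rewrite inE => /mem_take; rewrite mem_enum inE => /andP[].
rewrite cardsU (_ : _ :&: _ = set0) ?cards0 ?subn0; last first.
  apply/setP => x; rewrite !inE; apply/negbTE/negP => /andP[xB] /mem_take.
  by rewrite mem_enum inE xB.
rewrite (cardsE (mem (take _ _))) (card_uniqP _) ?take_uniq ?enum_uniq //.
have := cardsID B C; rewrite (setIidPr BC) => CE.
by rewrite size_takel -?cardE; lia.
Qed.

Section Products.
Variables (A : comNzRingType) (I : finType) (l : I -> A).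
Implicit Types (a b : I -> nat) (E : set (I -> nat)) (B T : {set I}).

Lemma sum_unit_exp j T : j \in T -> (\sum_(i in T) unit_exp j i = 1)%N.
Proof.
move=> jT; rewrite (bigD1 j) //= big1 /unit_exp ?eqxx // => i /andP[_ /negPf ij].
by rewrite ij.
Qed.

Lemma ideal_exp_forms T m :
  ideal_exp (ideal_span [set l j | j in [set` T]]) m =
  monomial_ideal l [set a | (m <= \sum_(i in T) a i)%N].
Proof.
apply/seteqP; split.
  elim: m => [|m IHm].
    move=> x _; rewrite -[x]mulr1 -(mon0 l).
    case: (monomial_ideal_is_ideal l [set a | (0 <= \sum_(i in T) a i)%N]).
    by move=> _ _; apply; apply: mem_monomial_ideal.
  apply: ideal_span_min; first exact: monomial_ideal_is_ideal.
  move=> _ [x [y [xT /IHm ym ->]]]; rewrite mulrC.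
  case: (monomial_ideal_is_ideal l [set a | (m.+1 <= \sum_(i in T) a i)%N]).
  move=> _ _ EM; move: y ym x xT => y ym.
  apply: (@ideal_span_min _ _ [set x | monomial_ideal l _ (y * x)]).
    case: (monomial_ideal_is_ideal l [set a | (m.+1 <= \sum_(i in T) a i)%N]).
    move=> E0 ED _; split=> [|u v|u v] /=; first by rewrite mulr0.
      by rewrite mulrDr; apply: ED.
    by rewrite mulrCA; apply: EM.
  move=> _ [j /= jT <-]; rewrite mulrC; apply: monomial_ideal_shift.
  apply: monomial_idealS ym => a /= ma; rewrite /shift /= big_split /=.
  by rewrite sum_unit_exp // addn1.
apply: monomial_ideal_min; first exact: ideal_exp_is_ideal.
elim: m => // m IHm a /= ma.
have /exists_inP[j jT aj] : [exists i in T, (0 < a i)%N].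
  rewrite -[X in is_true X]negbK negb_exists_in; apply/negP => /forall_inP a0.
  by move: ma; rewrite big1 // => i /a0; rewrite -eqn0Ngt => /eqP.
rewrite (@mon_sub _ _ l (unit_exp j)) => [|i]; last first.
  by rewrite /unit_exp; case: eqP => // ->.
rewrite mon_unit mulrC; apply: ideal_expS_mem.
  by apply: sub_ideal_span; exists j.
apply: IHm => /=; rewrite sumnB => [|i _]; last first.
  by rewrite /unit_exp; case: eqP => // ->.
by rewrite sum_unit_exp //; lia.
Qed.

(** A Gale-Ryser argument: peel off one product of at least [d] distinct forms,
chosen so that the inequality for [r] follows from the one for r+1. The product
must contain all the forms of exponent greater than [r], since only these lose
when the truncation passes from r+1 to [r]; beyond [d] factors, it must contain
no other. *)
Lemma mon_mem_exp (J : set A) d :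
  (forall B, (d <= #|B|)%N -> J (mon l (fun i => i \in B))) ->
  forall r a, (r * d <= \sum_i minn (a i) r)%N -> ideal_exp J r (mon l a).
Proof.
move=> JB; elim=> // r IHr a ra.
pose H := [set i | (r < a i)%N]%SET; pose S := [set i | (0 < a i)%N]%SET.
have HS : H \subset S by apply/subsetP => i; rewrite !inE; apply: leq_ltn_trans.
have dS : (d <= #|S|)%N.
  rewrite -(leq_pmul2l (ltn0Sn r)) (leq_trans ra) // (bigID (mem S)) /=.
  rewrite [X in (_ + X)%N]big1 ?addn0 => [|i]; last first.
    by rewrite inE -eqn0Ngt => /eqP ->; rewrite min0n.
  by rewrite mulnC -sum_nat_const; apply: leq_sum => i _; apply: geq_minr.
have [B [HB BS Bc]] := exists_set_between (k := maxn d #|H|) HS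
  ltac:(by rewrite leq_maxr geq_max dS subset_leq_card).
have Ba i : ((i \in B) <= a i)%N.
  by case: (boolP (i \in B)) => // /(subsetP BS); rewrite inE.
rewrite (mon_sub l Ba) mulrC; apply: ideal_expS_mem.
  by apply: JB; rewrite Bc leq_maxl.
apply: IHr; have [dH|Hd] := leqP d #|H|.
  rewrite (leq_trans (n := (r * #|H|)%N)) ?leq_mul2l ?dH ?orbT //.
  rewrite mulnC -sum_nat_const [leqRHS](bigID (mem H)) /=.
  apply: leq_trans (leq_addr _ _); apply: leq_sum => i.
  by rewrite inE; case: (i \in B) => /=; lia.
have dB : (\sum_i (i \in B) = d)%N.
  rewrite -(maxn_idPl (ltnW Hd)) -Bc -sum1_card [RHS]big_mkcond.
  by apply: eq_bigr => i _; case: (i \in B).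
rewrite -(leq_add2r d) -mulSnr -[X in (_ <= _ + X)%N]dB -big_split /=.
apply: leq_trans ra _.
apply: leq_sum => i _; move: (Ba i) (subsetP HB i); rewrite inE.
by case: (i \in B) => /=; case: ltnP => //; lia.
Qed.

End Products.

(** * Exponents of the symbolic powers *)

Definition symbolic_exps (I : finType) (c m : nat) : set (I -> nat) :=
  [set a | forall T : {set I}, #|T| = c -> (m <= \sum_(i in T) a i)%N].


Section Combinatorics.
Variables (I : finType) (c : nat).
Implicit Types (a : I -> nat) (B T : {set I}).

Lemma symbolic_exps_indicator B :
  (#|I| - c < #|B|)%N -> symbolic_exps c 1 (fun i => i \in B : nat).
Proof.
move=> Bc T Tc; rewrite (big_setID B) /=.
have /set0Pn[i] : T :&: B != set0.
  rewrite -card_gt0; have := cardsU T B; have := max_card (T :|: B); lia.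
move=> iTB; have iB : i \in B by move: iTB; rewrite inE => /andP[].
by rewrite (bigD1 i iTB) /= iB -addnA add1n.
Qed.

(** At most c-1 of the exponents vanish. *)
Lemma symbolic_exps_degree a : (c <= #|I|)%N ->
  symbolic_exps c 1 a -> (#|I| - c < \sum_i a i)%N.
Proof.
move=> cI ac; pose Z := [set i | a i == 0%N]%SET.
have Zc : (#|Z| < c)%N.
  rewrite ltnNge; apply/negP => cZ.
  have [T [_ TZ Tc]] := exists_set_between (sub0set Z) (k := c)
    ltac:(by rewrite cards0 cZ).
  have := ac T Tc; rewrite big1 // => i /(subsetP TZ); rewrite inE.
  by move/eqP.
have : (#|~: Z| <= \sum_i a i)%N.
  rewrite -sum1_card big_mkcond; apply: leq_sum => i _.
  by rewrite !inE; case: (a i).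
by have := cardsC Z; lia.
Qed.

(** When the truncated sum is small, at least [c] exponents are below [r]. The
smallest sums over [c] indices are then attained on untouched exponents, so
truncation at [r] does not decrease their minimum. *)
Lemma symbolic_exps_truncate m r a : (c <= #|I|)%N ->
  symbolic_exps c m a -> (\sum_i minn (a i) r < r * (#|I| - c).+1)%N ->
  symbolic_exps c m (fun i => minn (a i) r).
Proof.
move=> cI ac small T Tc; pose L := [set i | (a i < r)%N]%SET.
have cL : (c <= #|L|)%N.
  have : (r * #|~: L| < r * (#|I| - c).+1)%N.
    apply: leq_ltn_trans small; rewrite mulnC -sum_nat_const.
    rewrite [leqRHS](bigID (mem (~: L))) /=.
    apply: leq_trans (leq_addr _ _); apply: leq_sum => i.
    by rewrite !inE -leqNgt => /minn_idPr ->.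
  by have := cardsC L; rewrite ltn_mul2l => ? /andP[_]; lia.
(* Trade the indices of T with a large exponent for ones with a small one. *)
have [T' [TT' T'L T'c]] := exists_set_between (subsetIr T L) (k := c)
  ltac:(by rewrite -{1}Tc subset_leq_card ?subsetIl).
apply: leq_trans (ac T' T'c) _.
rewrite (big_setID (T :&: L)) [leqRHS](big_setID L) /= (setIidPr TT').
apply: leq_add.
  apply: leq_sum => i; rewrite !inE => /andP[_ iL].
  by rewrite (minn_idPl (ltnW iL)).
rewrite (leq_trans (n := (#|T' :\: (T :&: L)| * r)%N)) //.
  rewrite -sum_nat_const; apply: leq_sum => i.
  rewrite inE => /andP[_ /(subsetP T'L)]; by rewrite inE => /ltnW.
have -> : #|T' :\: (T :&: L)| = #|T :\: L|.
  have := cardsID (T :&: L) T'; have := cardsID L T; rewrite (setIidPr TT'); lia.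
rewrite -sum_nat_const; apply: leq_sum => i; rewrite !inE -leqNgt => /andP[ri _].
by rewrite (minn_idPr ri).
Qed.

End Combinatorics.

(** * The containment criterion for families of linear forms *)

Section Polynomials.
Variables (K : fieldType) (N : nat).
Implicit Types (p q : mpoly N K).

Definition order_ge k : set (mpoly N K) :=
  [set p | forall m, m \in msupp p -> (k <= mdeg m)%N].

Lemma order_ge_is_ideal k : is_ideal (order_ge k).
Proof.
split=> [m|p q pk qk m /msuppD_le|p q qk m /msuppM_le].
- by rewrite msupp0.
- by rewrite mem_cat => /orP[/pk|/qk].
case/allpairsP=> -[m1 m2] /= [_ /qk km ->].
by rewrite mdegD; apply: leq_trans km (leq_addl _ _).
Qed.

Lemma order_geM i j p q : order_ge i p -> order_ge j q -> order_ge (i + j) (p * q).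
Proof.
move=> pi qj m /msuppM_le /allpairsP[[m1 m2] /= [/pi im /qj jm ->]].
by rewrite mdegD leq_add.
Qed.

Lemma mon_homog (I : finType) (l : I -> mpoly N K) (a : I -> nat) :
  (forall i, l i \is ishomog1 1 mdeg) -> 
  mon l a \is ishomog1 (\sum_i a i)%N mdeg.
Proof.
move=> lh; rewrite /mon.
apply: (big_ind2 (fun p k => p \is ishomog1 k mdeg)) => [|p i q j|i _].
- exact: dhomog1.
- exact: dhomogM.
by have := dhomogMn (a i) (lh i); rewrite mul1n.
Qed.

(** The right-hand side depends on [s], [c], [m] and [r] only: this is what makes
the resurgence independent of the forms. *)
Theorem star_containment (s c : nat) (l : 'I_s -> mpoly N K) (m r : nat) :
  (c <= s)%N -> (forall i, l i \is ishomog1 1 mdeg) -> (forall i, l i != 0) ->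
  regular_family l c.+1 ->
  star_symbolic_power c l m `<=` ideal_exp (star_ideal c l) r <->
  forall a : 'I_s -> nat, symbolic_exps c m a ->
    (r * (s - c).+1 <= \sum_i minn (a i) r)%N.
Proof.
move=> cs lh l0 reg.
(* The inductive theorem with no form killed and no shift. *)
have symE k : star_symbolic_power c l k = monomial_ideal l (symbolic_exps c k).
  apply/seteqP; split=> f fk; last first.
    move=> T /= Tc; rewrite ideal_exp_forms; apply: monomial_idealS fk.
    by move=> a /(_ T Tc).
  have := @monomial_star_intersection _ _ _ _ reg c set0 (fun=> 0%N) k f.
  rewrite cards0 add0n => /(_ (ltnSn c)) H.
  have : monomial_ideal l (star_exps set0 (fun=> 0%N) k c) f.
    apply: H => T _ Tc; have := fk T Tc; rewrite ideal_exp_forms.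
    apply: monomial_idealS => a /= ka; left => /=.
    by under eq_bigr do rewrite addn0.
  apply: monomial_idealS => a [/= H' T Tc|[i]]; last by rewrite inE.
  have := H' T; rewrite setC0 subsetT => /(_ isT Tc).
  by under eq_bigr do rewrite addn0.
have idE : star_ideal c l = monomial_ideal l (symbolic_exps c 1).
  rewrite -symE; apply: eq_bigcapr => T _.
  by rewrite ideal_exp1 //; apply: ideal_span_is_ideal.
rewrite symE idE; split=> [sub a ma|comb]; last first.
  apply: monomial_ideal_min => [|a ma]; first exact: ideal_exp_is_ideal.
  apply: (@mon_mem_exp _ _ _ _ (s - c).+1); last exact: comb.
  move=> B; rewrite -{1}[s]card_ord => cB; apply: mem_monomial_ideal.
  exact: symbolic_exps_indicator.
(* The truncation of a bad exponent is a witness of degree less than r d. *)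
rewrite leqNgt; apply/negP => small.
pose t i := minn (a i) r.
have tm : symbolic_exps c m t.
  by apply: symbolic_exps_truncate; rewrite ?card_ord.
have Jd : monomial_ideal l (symbolic_exps c 1) `<=` order_ge (s - c).+1.
  apply: monomial_ideal_min => [|b b1 u]; first exact: order_ge_is_ideal.
  move/(dhomog_mf (mon_homog b lh)) => ->.
  by have := symbolic_exps_degree _ b1; rewrite card_ord; apply.
have tr : order_ge ((s - c).+1 * r) (mon l t).
  apply: (ideal_exp_filtration order_ge_is_ideal _ order_geM Jd).
    by apply/seteqP; split=> // p _ u.
  by apply: sub; apply: mem_monomial_ideal.
have t0 : mon l t != 0 by apply/prodf_neq0 => i _; rewrite expf_neq0.
have /tr := mlead_supp t0.
rewrite (dhomog_mf (mon_homog t lh) (mlead_supp t0)).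
by rewrite mulnC leqNgt small.
Qed.

(** Membership in a monomial ideal of a polynomial ring is read off the support,
so colons by variables are computed on exponents. The map [f] sends the [k] forms
that matter to variables, and [g] brings the conclusion back. *)
Lemma regular_family_coordinates (A : comNzRingType) (I : finType) (l : I -> A)
    (k : nat) :
  (forall U : {set I}, (#|U| <= k)%N ->
     exists (u : 'I_N -> I) (f : {rmorphism A -> mpoly N K})
       (g : {rmorphism mpoly N K -> A}),
     [/\ injective u, U \subset codom u, cancel f g &
         forall j, f (l (u j)) = mpolyX K (mnm1 j)]) ->
  regular_family l k.
Proof.
move=> coords E U s h Uk Eup EU Eh.
have [u [f [g [uI Uu fgK fu]]]] := coords _ Uk.
(* The exponent vector supported on the image of u that corresponds to m. *)
pose ext (m : multinom N) : I -> nat := fun i => (\sum_(j | u j == i) m j)%N.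
have extu m j : ext m (u j) = m j.
  by rewrite /ext (eq_bigl (pred1 j)) ?big_pred1_eq // => j'; rewrite /= (inj_eq uI).
have ext_out m i : i \notin codom u -> ext m i = 0%N.
  move=> iu; rewrite /ext big_pred0 // => j; apply/negP => /eqP ji.
  by rewrite -ji codom_f in iu.
have f_mon_ext m : f (mon l (ext m)) = mpolyX K m.
  have -> : mon l (ext m) = \prod_j l (u j) ^+ m j.
    rewrite /mon /ext; under eq_bigr do rewrite expr_sum.
    rewrite (exchange_big_dep predT) //=; apply: eq_bigr => j _.
    by rewrite (big_pred1 (u j)) // => i; rewrite /= eq_sym.
  rewrite mpolyXE_id rmorph_prod /=; apply: eq_bigr => j _.
  by rewrite rmorphXn fu.
(* The monomial ideal to which f maps the ideal of exponents E: as E ignores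
   the indices out of U, one may delete the other forms from its monomials. *)
pose W : set (mpoly N K) := [set p | forall m, m \in msupp p -> E (ext m)].
have extD m1 m2 i : ext (mnm_add m1 m2) i = (ext m1 i + ext m2 i)%N.
  by rewrite /ext -big_split; apply: eq_bigr => j _; rewrite mnmDE.
have W_ideal : is_ideal W.
  split=> [m|p q pW qW m /msuppD_le|p q qW m /msuppM_le].
  - by rewrite msupp0.
  - by rewrite mem_cat => /orP[/pW|/qW].
  case/allpairsP=> -[m1 m2] /= [_ /qW mW ->].
  by apply: Eup mW => i; rewrite extD leq_addl.
have fW : W (f (l s * h)).
  move: (l s * h) Eh; apply: (@monomial_ideal_min _ _ _ _ (f @^-1` W)).
    case: W_ideal => W0 WD WM; split=> [|x y|x y] /=; first by rewrite rmorph0.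
      by rewrite rmorphD; apply: WD.
    by rewrite rmorphM; apply: WM.
  move=> a Ea /=; pose m : multinom N := Multinom [tuple a (u j) | j < N].
  have ma i : (ext m i <= a i)%N.
    have [/codomP[j ->]|/ext_out -> //] := boolP (i \in codom u).
    by rewrite extu mnmE.
  rewrite (mon_sub l ma) rmorphM f_mon_ext; case: W_ideal => _ _; apply.
  move=> m'; rewrite msuppX inE => /eqP ->.
  apply: EU Ea => i iU; have /codomP[j ->] : i \in codom u.
    by apply: (subsetP Uu); rewrite !inE iU orbT.
  by rewrite extu mnmE.
have /codomP[j sE] : s \in codom u by apply: (subsetP Uu); rewrite !inE eqxx.
rewrite -(fgK h) [f h]mpolyE rmorph_sum /=.
apply: is_ideal_sum => [|m _]; first exact: monomial_ideal_is_ideal.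
have [->|m_h] := eqVneq (mcoeff m (f h)) 0.
  rewrite scale0r rmorph0; by case: (monomial_ideal_is_ideal l (shift s E)).
rewrite -mul_mpolyC rmorphM -f_mon_ext fgK.
case: (monomial_ideal_is_ideal l (shift s E)) => _ _; apply.
apply: mem_monomial_ideal; rewrite /shift /=.
have : mnm_add (mnm1 j) m \in msupp (f (l s * h)).
  rewrite rmorphM sE fu mulrC (perm_mem (msuppMX _ _)); apply: map_f.
  by rewrite mcoeff_msupp.
move/fW; apply: Eup => i; rewrite extD addnC leq_add2l.
have [/codomP[j' ->]|/ext_out -> //] := boolP (i \in codom u).
by rewrite extu mnm1E /unit_exp sE (inj_eq uI) eq_sym.
Qed.

End Polynomials.

(** * Generic linear forms and coordinates *)

Lemma linear_form_expand (K : fieldType) (N : nat) (p : mpoly N K) :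
  p \is ishomog1 1 mdeg ->
  p = \sum_j mcoeff (mnm1 j) p *: mpolyX K (mnm1 j).
Proof.
move=> p1; apply/mpolyP => m; rewrite raddf_sum /=.
under eq_bigr do rewrite mcoeffZ mcoeffX.
have [/mdeg1P[j /eqP ->]|m1] := boolP (mdeg m == 1%N).
  rewrite (bigD1 j) //= eqxx mulr1 big1 ?addr0 // => i /negPf ij.
  suff -> : (mnm1 i == mnm1 j) = false by rewrite mulr0.
  apply: contraFF ij => /eqP/mnmP/(_ i).
  by rewrite !mnm1E eqxx eq_sym; case: (i == j).
rewrite (dhomog_nemf_coeff p1 m1) big1 // => j _.
by case: eqP => [E|_]; rewrite ?mulr0 //; move: m1; rewrite -E mdeg1.
Qed.

(** Linearly independent linear forms, as many as the variables, are images of the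
variables under an invertible linear substitution. *)
Lemma linear_basis_coordinates (K : fieldType) (N : nat) (y : 'I_N -> mpoly N K) :
  (forall i, y i \is ishomog1 1 mdeg) ->
  (forall v : 'I_N -> K, \sum_i v i *: y i = 0 -> forall i, v i = 0) ->
  exists f g : {rmorphism mpoly N K -> mpoly N K},
    cancel f g /\ forall i, f (y i) = mpolyX K (mnm1 i).
Proof.
move=> y1 yfree; pose X i := mpolyX K (mnm1 i : multinom N).
pose L := \matrix_(i, j) mcoeff (mnm1 j) (y i).
have yE i : y i = \sum_j L i j *: X j.
  by rewrite {1}(linear_form_expand (y1 i)); apply: eq_bigr => j _; rewrite mxE.
have combE (P Q : 'M[K]_N) (w z : 'I_N -> mpoly N K) i :
    (forall j, w j = \sum_k Q j k *: z k) ->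
    \sum_j P i j *: w j = \sum_k (P *m Q) i k *: z k.
  move=> wE; under eq_bigr do rewrite wE scaler_sumr.
  rewrite exchange_big; apply: eq_bigr => k _ /=.
  by rewrite mxE scaler_suml; apply: eq_bigr => j _; rewrite scalerA.
have L_unit : L \in unitmx.
  rewrite -row_free_unit; apply: inj_row_free => v vL; apply/rowP => i.
  rewrite mxE; apply: yfree.
  under eq_bigr do rewrite yE scaler_sumr.
  rewrite exchange_big big1 // => k _ /=; under eq_bigr do rewrite scalerA.
  rewrite -scaler_suml; have /rowP/(_ k) := vL; rewrite !mxE => ->.
  by rewrite scale0r.
pose C := invmx L.
have idE i (z : 'I_N -> mpoly N K) : \sum_k (1%:M : 'M[K]_N) i k *: z k = z i.
  rewrite (bigD1 i) //= big1 ?addr0 => [|k ki]; first by rewrite mxE eqxx scale1r.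
  by rewrite mxE eq_sym (negPf ki) scale0r.
exists (comp_mpoly [tuple \sum_k C j k *: X k | j < N]),
       (comp_mpoly [tuple y j | j < N]); split=> [p|i].
  rewrite /= [in RHS](mpolyE p) (comp_mpolyE p) raddf_sum /=.
  apply: eq_bigr => m _; rewrite comp_mpolyZ rmorph_prod mpolyXE_id /=.
  congr (_ *: _); apply: eq_bigr => j _; rewrite rmorphXn tnth_mktuple raddf_sum /=.
  congr (_ ^+ _).
  under eq_bigr do rewrite comp_mpolyZ comp_mpolyXU -tnth_nth tnth_mktuple.
  by rewrite (combE _ L _ X) // mulVmx // idE.
rewrite yE raddf_sum /=.
under eq_bigr do rewrite comp_mpolyZ comp_mpolyXU -tnth_nth tnth_mktuple.
by rewrite (combE _ C _ X) // mulmxV // idE.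
Qed.

(** A set of at most n+1 indices extends to one of exactly n+1, and the forms
indexed by the latter are a basis of the linear forms. *)
Lemma regular_family_generic (K : fieldType) (n s : nat)
    (l : 'I_s -> dhomog n.+1 K 1) :
  (n < s)%N -> generic_collection l ->
  regular_family (fun i => mpoly_of_dhomog (l i)) n.+1.
Proof.
move=> ns gen; apply: (@regular_family_coordinates K n.+1) => U Un.
have [S [US _ Sc]] := exists_set_between (subsetT U) (k := n.+1)
  ltac:(by rewrite Un cardsT card_ord).
pose u j := enum_val (cast_ord (esym Sc) j).
have SE : [seq l j | j in S] = [tuple l (u j) | j < n.+1].
  apply: (@eq_from_nth _ 0) => [|i].
    by rewrite size_image size_tuple.
  rewrite size_image Sc => i_n.
  rewrite (nth_map (u (Ordinal i_n))) -?cardE ?Sc //.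
  rewrite -[in RHS](tnth_nth _ _ (Ordinal i_n)) tnth_mktuple.
  by congr (l _); rewrite [RHS](enum_val_nth (u (Ordinal i_n))).
have := gen S Sc; rewrite SE => /freeP lfree.
have [i||f [g [fgK fl]]] :=
  linear_basis_coordinates (y := fun j => mpoly_of_dhomog (l (u j))).
- exact: dhomog_is_dhomog.
- move=> v v0; apply: lfree.
  under eq_bigr do rewrite -tnth_nth tnth_mktuple.
  by apply: val_inj; rewrite /= raddf_sum.
exists u, f, g; split=> //.
- by apply: inj_comp; [apply: enum_val_inj|apply: cast_ord_inj].
- apply/subsetP => i /(subsetP US) iS; apply/codomP.
  exists (cast_ord Sc (enum_rank_in iS i)).
  by rewrite /u cast_ordK enum_rankK_in.
Qed.

Lemma generic_form_neq0 (K : fieldType) (n s : nat)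
    (l : 'I_s -> dhomog n.+1 K 1) i :
  (n < s)%N -> generic_collection l -> mpoly_of_dhomog (l i) != 0.
Proof.
move=> ns gen.
have [S [iS _ Sc]] := exists_set_between (subsetT [set i]%SET) (k := n.+1)
  ltac:(by rewrite cards1 cardsT card_ord).
have /free_not0 := gen S Sc; move/(_ (l i)).
rewrite image_f; last by rewrite -sub1set.
by move/(_ isT); apply: contra => /eqP l0; apply/eqP/val_inj.
Qed.

Theorem proposition3p5 (R : realType) (K : fieldType) (n s c : nat)
    (l : 'I_s -> dhomog n.+1 K 1) :
  (n.+1 <= s)%N ->
  generic_collection l ->
  (1 <= c)%N -> (c <= n)%N ->
  star_resurgence R c (fun i => mpoly_of_dhomog (l i)) =
  star_resurgence R c (coordinate_forms K (s := s)).
Proof.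
move=> ns gen _ cn.
have cs : (c <= s)%N by apply: leq_trans cn (ltnW ns).
have generic := star_containment _ _ cs (fun i => dhomog_is_dhomog (l i))
  (fun i => generic_form_neq0 i ns gen).
have coordinate := star_containment (l := coordinate_forms K (s := s)) _ _ cs.
have same m r :
  star_symbolic_power c (fun i => mpoly_of_dhomog (l i)) m
    `<=` ideal_exp (star_ideal c (fun i => mpoly_of_dhomog (l i))) r <->
  star_symbolic_power c (coordinate_forms K (s := s)) m
    `<=` ideal_exp (star_ideal c (coordinate_forms K (s := s))) r.
  apply: (iff_trans (generic m r _)); last apply: iff_sym (coordinate m r _ _ _).
  - move=> E U i h Uc; apply: (regular_family_generic ns gen).
    exact: leq_trans Uc _.
  - by move=> i; rewrite dhomogX; apply/eqP; apply: mdeg1.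
  - by move=> i; rewrite -msupp_eq0 msuppX.
  - apply: (@regular_family_coordinates K s) => U _.
    exists id, idfun, idfun; split=> //.
    by apply/subsetP => i _; apply/codomP; exists i.
congr ereal_sup; apply/seteqP; split=> x [m [r [m0 r0 ncont ->]]];
  by exists m, r; split=> // cont; apply: ncont; apply/same.
Qed.
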